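(* For $(\gamma_1,\delta_1),(\gamma_2,\delta_2)\in J_\otimes$ let $\mathsf T(\gamma_1,\delta_1;\gamma_2,\delta_2)$ denote the two-faced universal product of states associated with the universal lifts $(\lambda^{\gamma_1},\rho^{\delta_1})$ (face 1) and $(\lambda^{\gamma_2},\rho^{\delta_2})$ (face 2) to the tensor product. The universal products of states $\mathsf T(\gamma_1,\delta_1;\gamma_2,\delta_2)$ are classified into the following nine families with continuous parameter $\zeta\in\mathbb T$ and seven isolated products; that is, each $\mathsf T(\gamma_1,\delta_1;\gamma_2,\delta_2)$ with $(\gamma_i,\delta_i)\in J_\otimes$ coincides with exactly one of the following (which are pairwise distinct, also for different values of $\zeta$): nine families ($\zeta\in\mathbb T$): $\mathsf T(\zeta,\zeta;1,1)$, $\mathsf T(\zeta,\zeta;1,0)$, $\mathsf T(\zeta,\zeta;0,1)$, $\mathsf T(\zeta,0;1,1)$, $\mathsf T(\zeta,0;1,0)$, $\mathsf T(\zeta,0;0,1)$, $\mathsf T(0,\zeta;1,1)$, $\mathsf T(0,\zeta;1,0)$, $\mathsf T(0,\zeta;0,1)$; seven isolated products: $\mathsf T(1,1;0,0)$, $\mathsf T(1,0;0,0)$, $\mathsf T(0,1;0,0)$, $\mathsf T(0,0;1,1)$, $\mathsf T(0,0;1,0)$, $\mathsf T(0,0;0,1)$, $\mathsf T(0,0;0,0)$.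
   Context: $\mathbb T=\{z\in\mathbb C:|z|=1\}$ and $J_\otimes=\{(\gamma,\delta)\in(\mathbb T\cup\{0\})^2:\gamma=\delta\text{ or }\gamma=0\text{ or }\delta=0\}$. Pre-Hilbert spaces. All pre-Hilbert spaces are complex, with inner product linear in the second argument, and equipped with a distinguished unit vector, always denoted $\Omega$; $\hat H=H\ominus\mathbb C\Omega$. $L_{\mathrm a}(H)$ is the $\ast$-algebra of adjointable linear operators on $H$. $P_\Omega$ is the orthogonal projection onto $\mathbb C\Omega$, $P_{\Omega^\perp}=\mathrm{id}-P_\Omega$. In $H\otimes G$ (algebraic tensor product) the unit vector is $\Omega\otimes\Omega$, also written $\Omega$. The map $T\mapsto T_\gamma$. With respect to $H=\mathbb C\Omega\oplus\hat H$ write $T=\begin{pmatrix}\tau&(t')^*\\ t&\hat T\end{pmatrix}$ with $\tau\in\mathbb C$, $t,t'\in\hat H$, $\hat T\in L_{\mathrm a}(\hat H)$, where $(t')^*$ denotes $h\mapsto\langle t',h\rangle$. Then $T_\gamma:=\begin{pmatrix}|\gamma|\tau&(\gamma t')^*\\ \gamma t&|\gamma|\hat T\end{pmatrix}$. Lifts. $\lambda^\gamma_{H,G}(X)=X\otimes P_\Omega+X_\gamma\otimes P_{\Omega^\perp}$ for $X\in L_{\mathrm a}(H)$ and $\rho^\delta_{H,G}(Y)=P_\Omega\otimes Y+P_{\Omega^\perp}\otimes Y_\delta$ for $Y\in L_{\mathrm a}(G)$; these are $\ast$-homomorphisms into $L_{\mathrm a}(H\otimes G)$ for $\gamma,\delta\in\mathbb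 T\cup\{0\}$. $\ast$-algebras and states. $\ast$-algebras are over $\mathbb C$ and not assumed unital; $\sqcup$ is the non-unital free product (coproduct) of $\ast$-algebras. A linear functional is a state if its unital extension to the unitization is positive. A two-faced $\ast$-algebra is a $\ast$-algebra $A$ with $\ast$-subalgebras $A^{(1)},A^{(2)}$ such that $A=A^{(1)}\sqcup A^{(2)}$ canonically. Associated product of states. Let $\phi,\psi$ be states on two-faced $\ast$-algebras $A=A^{(1)}\sqcup A^{(2)}$, $B=B^{(1)}\sqcup B^{(2)}$. Choose $\ast$-representations (i.e. $\ast$-homomorphisms) $\pi\colon A\to L_{\mathrm a}(H)$, $\sigma\colon B\to L_{\mathrm a}(G)$ with $\phi=\langle\Omega,\pi(\cdot)\Omega\rangle$, $\psi=\langle\Omega,\sigma(\cdot)\Omega\rangle$. Let $\Pi\colon A\sqcup B\to L_{\mathrm a}(H\otimes G)$ be the $\ast$-homomorphism with $\Pi(a)=\lambda^{\gamma_i}_{H,G}(\pi(a))$ for $a\in A^{(i)}$ and $\Pi(b)=\rho^{\delta_i}_{H,G}(\sigma(b))$ for $b\in B^{(i)}$, $i=1,2$. The product of $\phi$ and $\psi$ under $\mathsf T(\gamma_1,\delta_1;\gamma_2,\delta_2)$ is the state $c\mapsto\langle\Omega,\Pi(c)\Omega\rangle$ on $A\sqcup B$; it does not depend on the choice of $\pi,\sigma$. Two such products coincide if they give the same state for all choices of $A,B,\phi,\psi$. *)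

(* Defs.v *)
From HB Require Import structures.
From mathcomp Require Import all_boot all_order all_algebra.
From mathcomp Require Import ssrAC boolp classical_sets functions reals.
From mathcomp Require Export complex.
Set Implicit Arguments.
Unset Strict Implicit.
Unset Printing Implicit Defensive.
Import Order.TTheory GRing.Theory Num.Theory.
Local Open Scope ring_scope.

(* Everything is written over an abstract algebraically closed numeric field
   [C]; the theorem takes [C := R[i]] with [R : realType].  On such a [C],
   [0 <= z] means that [z] is real and nonnegative, and [`|z|] is again an
   element of [C]. *)

HB.mixin Record isStarAlgebra (C : numClosedFieldType) A of GRing.Lmodule C A := {
  smul : A -> A -> A;
  star : A -> A;
  smulA : associative smul;
  smulDl : left_distributive smul +%R;
  smulDr : right_distributive smul +%R;
  smulZl : forall (k : C) x y, smul (k *: x) y = k *: smul x y;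
  smulZr : forall (k : C) x y, smul x (k *: y) = k *: smul x y;
  starK : involutive star;
  starD : {morph star : x y / x + y};
  starZ : forall (k : C) x, star (k *: x) = k^* *: star x;
  starM : forall x y, star (smul x y) = smul (star y) (star x)
}.

#[short(type="starAlgType")]
HB.structure Definition StarAlgebra (C : numClosedFieldType) :=
  {A of isStarAlgebra C A & GRing.Lmodule C A}.

Definition star_hom (C : numClosedFieldType) (A B : starAlgType C)
    (f : A -> B) : Prop :=
  [/\ linear f, {morph f : x y / smul x y} & {morph f : x / star x}].

Section Unitization.
Variables (C : numClosedFieldType) (A : starAlgType C).

Definition unitization : Type := (C^o * A)%type.

HB.instance Definition _ := GRing.Lmodule.on unitization.

Definition unit_mul (u v : unitization) : unitization :=
  (u.1 * v.1, u.1 *: v.2 + v.1 *: u.2 + smul u.2 v.2).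
Definition unit_star (u : unitization) : unitization := ((u.1 : C)^*, star u.2).

Fact unit_ext (u v : unitization) : u.1 = v.1 -> u.2 = v.2 -> u = v.
Proof. by case: u v => [a x] [b y] /= -> ->. Qed.

Fact unit_mulA : associative unit_mul.
Proof.
move=> [a x] [b y] [c z]; apply: unit_ext => /=; first by rewrite mulrA.
rewrite !scalerDr !smulDr !smulDl !smulZl !smulZr !scalerA smulA.
rewrite [c * a]mulrC [c * b]mulrC.
by rewrite [LHS](AC (3*1*3) ((1*(2*4*6))*(3*5*7))).
Qed.

Fact unit_mulDl : left_distributive unit_mul +%R.
Proof.
move=> u v w; apply: unit_ext; first exact: mulrDl.
by rewrite /= scalerDl scalerDr smulDl [LHS](AC (2*2*2) ((1*3*5)*(2*4*6))).
Qed.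

Fact unit_mulDr : right_distributive unit_mul +%R.
Proof.
move=> u v w; apply: unit_ext; first exact: mulrDr.
by rewrite /= scalerDl scalerDr smulDr [LHS](AC (2*2*2) ((1*3*5)*(2*4*6))).
Qed.

Fact unit_mulZl (k : C) u v : unit_mul (k *: u) v = k *: unit_mul u v.
Proof.
apply: unit_ext; first by rewrite /= [RHS]mulrA.
by rewrite /= !scalerDr smulZl !scalerA [v.1 * k]mulrC.
Qed.

Fact unit_mulZr (k : C) u v : unit_mul u (k *: v) = k *: unit_mul u v.
Proof.
apply: unit_ext; first by rewrite /= [LHS]mulrCA.
by rewrite /= !scalerDr smulZr !scalerA [u.1 * k]mulrC.
Qed.

Fact unit_starK : involutive unit_star.
Proof. by move=> [a x]; rewrite /unit_star /= conjCK starK. Qed.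

Fact unit_starD : {morph unit_star : u v / u + v}.
Proof. by move=> [a x] [b y]; rewrite /unit_star /= rmorphD starD. Qed.

Fact unit_starZ (k : C) u : unit_star (k *: u) = k^* *: unit_star u.
Proof. by case: u => [a x]; rewrite /unit_star /= rmorphM starZ. Qed.

Fact unit_starM u v : unit_star (unit_mul u v) = unit_mul (unit_star v) (unit_star u).
Proof.
case: u v => [a x] [b y]; apply: unit_ext => /=.
  by rewrite rmorphM mulrC.
by rewrite !starD !starZ starM (addrC (_ *: star y)).
Qed.

HB.instance Definition _ := isStarAlgebra.Build C unitization
  unit_mulA unit_mulDl unit_mulDr unit_mulZl unit_mulZr
  unit_starK unit_starD unit_starZ unit_starM.

Definition unital_extension (phi : A -> C) (u : unitization) : C := u.1 + phi u.2.

End Unitization.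

Definition positive_functional (C : numClosedFieldType) (A : starAlgType C)
    (f : A -> C) : Prop :=
  forall x : A, 0 <= f (smul (star x) x).

Definition state (C : numClosedFieldType) (A : starAlgType C)
    (phi : A -> C) : Prop :=
  linear (phi : A -> C^o) /\ positive_functional (unital_extension phi).

(* The non-unital free product, by its universal property: it is determined up
   to a unique *-isomorphism compatible with the inclusions. *)

Definition is_coproduct (C : numClosedFieldType) (A B P : starAlgType C)
    (iA : A -> P) (iB : B -> P) : Prop :=
  [/\ star_hom iA, star_hom iB &
   forall (D : starAlgType C) (f : A -> D) (g : B -> D),
     star_hom f -> star_hom g ->
     exists! h : P -> D, [/\ star_hom h, h \o iA = f & h \o iB = g]].

Record coproduct (C : numClosedFieldType) (A B : starAlgType C) := Coproduct {
  cop_alg :> starAlgType C;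
  cop_inl : A -> cop_alg;
  cop_inr : B -> cop_alg;
  cop_prop : is_coproduct cop_inl cop_inr
}.

(* The two *-subalgebras are given by their injective inclusion maps; the
   injectivity also follows from [tf_prop]. *)
Record twoFaced (C : numClosedFieldType) := TwoFaced {
  tf_alg :> starAlgType C;
  face1 : starAlgType C;
  face2 : starAlgType C;
  incl1 : face1 -> tf_alg;
  incl2 : face2 -> tf_alg;
  incl1_inj : injective incl1;
  incl2_inj : injective incl2;
  tf_prop : is_coproduct incl1 incl2
}.

HB.mixin Record isPreHilbert (C : numClosedFieldType) H of GRing.Lmodule C H := {
  inner : H -> H -> C;
  Omega : H;
  inner_linear : forall h : H, linear (inner h : H -> C^o);
  inner_conj : forall h k : H, inner k h = (inner h k)^*;
  inner_ge0 : forall h : H, 0 <= inner h h;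
  inner_eq0 : forall h : H, inner h h = 0 -> h = 0;
  inner_Omega : inner Omega Omega = 1
}.

#[short(type="preHilbertType")]
HB.structure Definition PreHilbert (C : numClosedFieldType) :=
  {H of isPreHilbert C H & GRing.Lmodule C H}.

Arguments Omega {C s}.

Section Adjointable.
Variables (C : numClosedFieldType) (H : preHilbertType C).
Implicit Types (h k l : H) (S T : H -> H).

Definition is_adjoint T S : Prop := forall h k, inner h (T k) = inner (S h) k.

Definition adjointable : {pred (H -> H)} :=
  fun T => `[< linear T /\ exists S, linear S /\ is_adjoint T S >].

Lemma innerDr h k l : inner h (k + l) = inner h k + inner h l.
Proof. by have := inner_linear h 1 k l; rewrite !scale1r. Qed.
Lemma inner0r h : inner h 0 = 0.
Proof. by apply: (@addrI _ (inner h 0)); rewrite -innerDr !addr0. Qed.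
Lemma innerZr h a k : inner h (a *: k) = a * inner h k.
Proof. by have := inner_linear h a k 0; rewrite inner0r !addr0. Qed.
Lemma innerDl h k l : inner (k + l) h = inner k h + inner l h.
Proof. by rewrite inner_conj innerDr rmorphD /= -!inner_conj. Qed.
Lemma innerZl h a k : inner (a *: k) h = a^* * inner k h.
Proof. by rewrite inner_conj innerZr rmorphM /= -inner_conj. Qed.
Lemma innerBl h k l : inner (k - l) h = inner k h - inner l h.
Proof. by rewrite -scaleN1r innerDl innerZl rmorphN rmorph1 mulN1r. Qed.

Lemma inner_inj h k : (forall l, inner h l = inner k l) -> h = k.
Proof.
move=> e; apply/eqP; rewrite -subr_eq0; apply/eqP; apply: inner_eq0.
by rewrite innerBl e subrr.
Qed.

Fact adjointable_submod_closed : submod_closed adjointable.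
Proof.
split=> [|a T1 T2 /asboolP[l1 [S1 [m1 e1]]] /asboolP[l2 [S2 [m2 e2]]]].
  apply/asboolP; split; first by move=> b x y; rewrite /= scaler0 addr0.
  exists (fun=> 0); split; first by move=> b x y; rewrite scaler0 addr0.
  by move=> h k; rewrite inner0r inner_conj inner0r rmorph0.
apply/asboolP; split.
  move=> b x y; rewrite !fctE l1 l2 !scalerDr !scalerA (mulrC a b).
  by rewrite addrACA.
exists (fun h => a^* *: S1 h + S2 h); split.
  move=> b x y; rewrite m1 m2 !scalerDr !scalerA (mulrC _ b).
  by rewrite addrACA.
move=> h k; rewrite !fctE innerDr innerZr innerDl innerZl conjCK.
by rewrite e1 e2.
Qed.

HB.instance Definition _ :=
  GRing.isSubmodClosed.Build C (H -> H) adjointable adjointable_submod_closed.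

Record La := MkLa { La_fun :> H -> H; La_adj : La_fun \in adjointable }.

HB.instance Definition _ := [isSub for La_fun].
HB.instance Definition _ := [Choice of La by <:].
HB.instance Definition _ := [SubChoice_isSubLmodule of La by <:].

Lemma LaP (X Y : La) : X =1 Y -> X = Y.
Proof. by move=> e; apply: val_inj; apply: funext. Qed.

Lemma La_linear (X : La) : linear X.
Proof. by case: X => T /= /asboolP[]. Qed.

Lemma LaDE (X Y : La) h : (X + Y) h = X h + Y h. Proof. by []. Qed.
Lemma LaZE (a : C) (X : La) h : (a *: X) h = a *: X h. Proof. by []. Qed.

Lemma La_add (X : La) h k : X (h + k) = X h + X k.
Proof. by have := La_linear X 1 h k; rewrite !scale1r. Qed.
Lemma La_scale (X : La) a h : X (a *: h) = a *: X h.
Proof.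
have X0 : X 0 = 0 by apply: (@addrI _ (X 0)); rewrite -La_add !addr0.
by have := La_linear X a h 0; rewrite X0 !addr0.
Qed.

Fact La_adjoint_ex (X : La) : exists S, linear S /\ is_adjoint X S.
Proof. by case: X => T /= /asboolP[]. Qed.

Definition adj_fun (X : La) : H -> H := sval (cid (La_adjoint_ex X)).

Lemma adj_funP (X : La) h k : inner h (X k) = inner (adj_fun X h) k.
Proof. by rewrite /adj_fun; case: cid => S []. Qed.

Lemma is_adjointC T S : is_adjoint T S -> is_adjoint S T.
Proof. by move=> e h k; rewrite inner_conj -e -inner_conj. Qed.

Fact adj_fun_subproof (X : La) : adj_fun X \in adjointable.
Proof.
apply/asboolP; split; first by rewrite /adj_fun; case: cid => S [].
by exists X; split; [exact: La_linear|apply/is_adjointC/adj_funP].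
Qed.

Definition La_star (X : La) : La := MkLa (adj_fun_subproof X).

Lemma La_starP (X : La) h k : inner h (X k) = inner (La_star X h) k.
Proof. exact: adj_funP. Qed.

Lemma La_star_uniq (X Y : La) : is_adjoint X Y -> La_star X = Y.
Proof.
move=> e; apply: LaP => h; apply: inner_inj => l.
by rewrite -La_starP e.
Qed.

Fact comp_subproof (X Y : La) : (X \o Y : H -> H) \in adjointable.
Proof.
apply/asboolP; split; first by move=> a h k; rewrite /= !(La_add, La_scale).
exists (La_star Y \o La_star X); split.
  by move=> a h k; rewrite /comp !(La_add, La_scale).
by move=> h k; rewrite /comp !La_starP.
Qed.

Definition La_comp (X Y : La) : La := MkLa (comp_subproof X Y).

Lemma La_compE X Y h : La_comp X Y h = X (Y h). Proof. by []. Qed.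

Fact La_compA : associative La_comp. Proof. by move=> X Y Z; apply: LaP. Qed.
Fact La_compDl : left_distributive La_comp +%R.
Proof. by move=> X Y Z; apply: LaP. Qed.
Fact La_compDr : right_distributive La_comp +%R.
Proof. by move=> X Y Z; apply: LaP => h; rewrite LaDE !La_compE LaDE La_add. Qed.
Fact La_compZl (k : C) X Y : La_comp (k *: X) Y = k *: La_comp X Y.
Proof. exact: LaP. Qed.
Fact La_compZr (k : C) X Y : La_comp X (k *: Y) = k *: La_comp X Y.
Proof. by apply: LaP => h; rewrite LaZE !La_compE LaZE La_scale. Qed.
Fact La_starK : involutive La_star.
Proof. by move=> X; apply: La_star_uniq; apply/is_adjointC/La_starP. Qed.
Fact La_starD : {morph La_star : X Y / X + Y}.
Proof.
move=> X Y; apply: La_star_uniq => h k.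
by rewrite !LaDE innerDr innerDl !La_starP.
Qed.
Fact La_starZ (k : C) X : La_star (k *: X) = k^* *: La_star X.
Proof.
apply: La_star_uniq => h l.
by rewrite !LaZE innerZr innerZl conjCK La_starP.
Qed.
Fact La_starM X Y : La_star (La_comp X Y) = La_comp (La_star Y) (La_star X).
Proof. by apply: La_star_uniq => h k; rewrite !La_compE !La_starP. Qed.

HB.instance Definition _ := isStarAlgebra.Build C La
  La_compA La_compDl La_compDr La_compZl La_compZr
  La_starK La_starD La_starZ La_starM.

Fact id_subproof : (id : H -> H) \in adjointable.
Proof. by apply/asboolP; split=> //; exists id. Qed.
Definition La_id : La := MkLa id_subproof.

Fact proj_subproof : (fun h : H => inner Omega h *: (Omega : H)) \in adjointable.
Proof.
have lin : linear (fun h : H => inner Omega h *: (Omega : H)).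
  by move=> a h k; rewrite innerDr innerZr scalerDl scalerA.
apply/asboolP; split=> //; exists (fun h : H => inner Omega h *: (Omega : H)).
by split=> // h k; rewrite innerZr innerZl -inner_conj mulrC.
Qed.
Definition POmega : La := MkLa proj_subproof.
Definition Pperp : La := La_id - POmega.

(* In block form with respect to [C Omega] and its orthogonal complement, the
   four terms are the entries [|g| tau], [(g t')^* = g^* (t')^*], [g t] and
   [|g| T^]. *)
Definition twist (g : C) (T : La) : La :=
  `|g| *: smul POmega (smul T POmega) + g^* *: smul POmega (smul T Pperp)
  + g *: smul Pperp (smul T POmega) + `|g| *: smul Pperp (smul T Pperp).

End Adjointable.

Definition bilinear_map (C : numClosedFieldType) (U V W : lmodType C)
    (f : U -> V -> W) : Prop :=
  (forall u, linear (f u)) /\ (forall v, linear (f^~ v)).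

(* The algebraic tensor product, by its universal property for bilinear maps,
   with the inner product determined on elementary tensors. *)
Record tensorProduct (C : numClosedFieldType) (H G : preHilbertType C) :=
  TensorProduct {
  ten_space :> preHilbertType C;
  ten : H -> G -> ten_space;
  ten_bilinear : bilinear_map ten;
  ten_univ : forall (V : lmodType C) (f : H -> G -> V), bilinear_map f ->
    exists! F : ten_space -> V, linear F /\ forall h g, F (ten h g) = f h g;
  ten_inner : forall h h' g g',
    inner (ten h g) (ten h' g') = inner h h' * inner g g';
  ten_Omega : ten Omega Omega = Omega
}.

Section TensorOperators.
Variables (C : numClosedFieldType) (H G : preHilbertType C).
Variable (K : tensorProduct H G).

Lemma ten_ext (V : lmodType C) (F1 F2 : K -> V) : linear F1 -> linear F2 ->
  (forall h g, F1 (ten K h g) = F2 (ten K h g)) -> F1 = F2.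
Proof.
move=> l1 l2 e; have [bl br] := ten_bilinear K.
have bil : bilinear_map (fun h g => F2 (ten K h g)).
  by split=> u a x y; rewrite ?(bl u) ?(br u) l2.
have [F [_ uF]] := ten_univ K bil.
by rewrite -(uF F1) // -(uF F2).
Qed.

Fact ten_op_ex (X : La H) (Y : La G) :
  exists F : K -> K, linear F /\ forall h g, F (ten K h g) = ten K (X h) (Y g).
Proof.
have [bl br] := ten_bilinear K.
have bil : bilinear_map (fun h g => ten K (X h) (Y g)).
  split=> u a x y; first by rewrite La_linear bl.
  by rewrite /= La_linear br.
by have [F [lF _]] := ten_univ K bil; exists F.
Qed.

Definition ten_fun X Y : K -> K := sval (cid (ten_op_ex X Y)).

Fact ten_fun_linear X Y : linear (ten_fun X Y).
Proof. by rewrite /ten_fun; case: cid => F []. Qed.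

Fact ten_funE X Y h g : ten_fun X Y (ten K h g) = ten K (X h) (Y g).
Proof. by rewrite /ten_fun; case: cid => F []. Qed.

Fact ten_fun_adjoint X Y :
  is_adjoint (ten_fun X Y) (ten_fun (La_star X) (La_star Y)).
Proof.
have lin (Z : K -> K) u : linear Z -> linear (fun v => inner u (Z v) : C^o).
  by move=> lZ a x y; rewrite lZ inner_linear.
have main h g v : inner (ten K h g) (ten_fun X Y v) =
    inner (ten_fun (La_star X) (La_star Y) (ten K h g)) v.
  move: v; apply/funeqP; apply: (@ten_ext C^o).
  - exact/lin/ten_fun_linear.
  - exact: inner_linear.
  - by move=> h' g'; rewrite !ten_funE !ten_inner !La_starP.
move=> u v; rewrite inner_conj [RHS]inner_conj; congr (_^*).
move: u; apply/funeqP; apply: (@ten_ext C^o).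
- exact: inner_linear.
- exact/lin/ten_fun_linear.
- by move=> h g; rewrite inner_conj main -inner_conj.
Qed.

Fact ten_op_subproof X Y : ten_fun X Y \in @adjointable C K.
Proof.
apply/asboolP; split; first exact: ten_fun_linear.
exists (ten_fun (La_star X) (La_star Y)).
by split; [exact: ten_fun_linear|exact: ten_fun_adjoint].
Qed.

Definition ten_op (X : La H) (Y : La G) : La K := MkLa (ten_op_subproof X Y).

Definition left_lift (g : C) (X : La H) : La K :=
  ten_op X (POmega G) + ten_op (twist g X) (Pperp G).

Definition right_lift (d : C) (Y : La G) : La K :=
  ten_op (POmega H) Y + ten_op (Pperp H) (twist d Y).

End TensorOperators.

Definition circle (C : numClosedFieldType) (z : C) : Prop := `|z| = 1.

Definition Jtens (C : numClosedFieldType) (g d : C) : Prop :=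
  [/\ circle g \/ g = 0, circle d \/ d = 0 & [\/ g = d, g = 0 | d = 0]].

(* [TT g1 d1 g2 d2] stands for T(g1, d1; g2, d2). *)
Record lift_params (C : numClosedFieldType) := TT {
  gamma1 : C; delta1 : C; gamma2 : C; delta2 : C
}.

Definition represents (C : numClosedFieldType) (A : starAlgType C)
    (H : preHilbertType C) (pi : A -> La H) (phi : A -> C) : Prop :=
  star_hom pi /\ forall a, phi a = inner Omega (pi a Omega).

(* For states [phi] and [psi] and admissible parameters, the representations
   exist and the resulting state does not depend on them, so that exactly one
   [theta] is related to [phi] and [psi]; hence [coincide] below says that the
   two product states are equal. *)
Definition is_product (C : numClosedFieldType) (p : lift_params C)
    (A B : twoFaced C) (P : coproduct A B)
    (phi : A -> C) (psi : B -> C) (theta : P -> C) : Prop :=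
  exists (H G : preHilbertType C) (K : tensorProduct H G)
         (pi : A -> La H) (sigma : B -> La G) (Pi : P -> La K),
    represents pi phi /\ represents sigma psi /\ star_hom Pi /\
    (forall a : face1 A, Pi (cop_inl P (incl1 a)) =
                         left_lift K (gamma1 p) (pi (incl1 a))) /\
    (forall a : face2 A, Pi (cop_inl P (incl2 a)) =
                         left_lift K (gamma2 p) (pi (incl2 a))) /\
    (forall b : face1 B, Pi (cop_inr P (incl1 b)) =
                         right_lift K (delta1 p) (sigma (incl1 b))) /\
    (forall b : face2 B, Pi (cop_inr P (incl2 b)) =
                         right_lift K (delta2 p) (sigma (incl2 b))) /\
    (forall c : P, theta c = inner Omega (Pi c Omega)).

Definition coincide (C : numClosedFieldType) (p q : lift_params C) : Prop :=
  forall (A B : twoFaced C) (P : coproduct A B) (phi : A -> C) (psi : B -> C),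
    state phi -> state psi ->
    forall theta : P -> C,
      is_product p phi psi theta <-> is_product q phi psi theta.

Inductive listed (C : numClosedFieldType) : lift_params C -> Prop :=
| fam_zz11 z of circle z : listed (TT z z 1 1)
| fam_zz10 z of circle z : listed (TT z z 1 0)
| fam_zz01 z of circle z : listed (TT z z 0 1)
| fam_z011 z of circle z : listed (TT z 0 1 1)
| fam_z010 z of circle z : listed (TT z 0 1 0)
| fam_z001 z of circle z : listed (TT z 0 0 1)
| fam_0z11 z of circle z : listed (TT 0 z 1 1)
| fam_0z10 z of circle z : listed (TT 0 z 1 0)
| fam_0z01 z of circle z : listed (TT 0 z 0 1)
| iso_1100 : listed (TT 1 1 0 0)
| iso_1000 : listed (TT 1 0 0 0)
| iso_0100 : listed (TT 0 1 0 0)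
| iso_0011 : listed (TT 0 0 1 1)
| iso_0010 : listed (TT 0 0 1 0)
| iso_0001 : listed (TT 0 0 0 1)
| iso_0000 : listed (TT 0 0 0 0).

(* Main.v *)
From HB Require Import structures.
Require Import Defs.
From mathcomp Require Import all_boot all_order all_algebra reals.
From mathcomp Require Import ssrAC boolp functions finmap.
From mathcomp.multinomials Require Import monalg.
Set Implicit Arguments.
Unset Strict Implicit.
Unset Printing Implicit Defensive.

(* Coincidences: for [u] on the unit circle, the unitary of [H (x) G] that is
   [u] on the tensor product of the orthogonal complements of the unit vectors
   and the identity on the rest fixes [Omega] and conjugates the lifts with
   parameters [gamma], [delta] into those with [u gamma], [u delta]. Hence
   scaling all four parameters by [u] does not change the product state, and
   the last nonzero parameter can be made 1.

   Distinctness: let [a_i], [b_i] be self-adjoint elements of the [i]-th faces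
   that act on C^2 by exchanging [Omega] and the other basis vector [e]. Then
   [a_i b_j Omega = gamma_i (e (x) e)] and [b_i a_j Omega = delta_i (e (x) e)],
   so the product state recovers [x^* y] for all parameters [x], [y], and
   thereby the parameters up to a common phase. Free *-algebras on self-adjoint
   generators provide the two-faced algebras and their coproduct. *)

Import Order.TTheory GRing.Theory Num.Theory.
Local Open Scope ring_scope.

(** * Free *-algebras on self-adjoint generators *)

Section LinearExtension.
Variables (C : nzRingType) (K : choiceType).
Implicit Types (g : {malg C[K]}).

(** Only additivity is assumed, and coefficients stay inside the monomials, so that maps involving
    the conjugate-linear involution are covered too. *)
Lemma malg_additive_ext (V : zmodType) (F1 F2 : {malg C[K]} -> V) :
  {morph F1 : x y / x + y} -> {morph F2 : x y / x + y} ->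
  (forall c k, F1 << c *g k >> = F2 << c *g k >>) -> F1 =1 F2.
Proof.
move=> D1 D2 e g.
have F0 (F : {malg C[K]} -> V) : {morph F : x y / x + y} -> F 0 = 0.
  by move=> D; apply: (@addrI _ (F 0)); rewrite -D !addr0.
rewrite (monalgE g) (big_morph F1 D1 (F0 _ D1)) (big_morph F2 D2 (F0 _ D2)).
exact: eq_bigr.
Qed.

Lemma malgUZ c k : << c *g k >> = c *: << k >> :> {malg C[K]}.
Proof. by apply/malgP => l; rewrite mcoeffZ !mcoeffU mulrnAr mulr1. Qed.

Variables (V : lmodType C) (f : K -> V).

Definition mlift g : V := \sum_(k <- msupp g) g@_k *: f k.

(** Summing over a common superset of the supports lets two elements be added term by term; the
    extra terms have coefficient 0. *)
Lemma mliftEw (d : {fset K}) g : (msupp g `<=` d)%fset ->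
  mlift g = \sum_(k <- d) g@_k *: f k.
Proof.
move=> le; rewrite /mlift (big_fset_incl _ le) // => k _ nk.
by rewrite (mcoeff_outdom nk) scale0r.
Qed.

Lemma mlift_linear : linear mlift.
Proof.
move=> a g h; pose d := (msupp g `|` msupp h)%fset.
rewrite (@mliftEw d (a *: g + h)); last first.
  apply: (fsubset_trans (msuppD_le _ _)); apply: fsetUSS => //.
  exact: msuppZ_le.
rewrite (@mliftEw d g) ?fsubsetUl // (@mliftEw d h) ?fsubsetUr //.
rewrite scaler_sumr -big_split; apply: eq_bigr => k _ /=.
by rewrite mcoeffD mcoeffZ scalerDl scalerA.
Qed.

Lemma mliftD : {morph mlift : g h / g + h}.
Proof. by move=> g h; have := mlift_linear 1 g h; rewrite !scale1r. Qed.

Lemma mlift0 : mlift 0 = 0.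
Proof. by rewrite /mlift msupp0 big_seq_fset0. Qed.

Lemma mliftZ a g : mlift (a *: g) = a *: mlift g.
Proof. by have := mlift_linear a g 0; rewrite mlift0 !addr0. Qed.

Lemma mliftU1 k : mlift << k >> = f k.
Proof. by rewrite /mlift msuppU oner_eq0 big_seq_fset1 mcoeffUU scale1r. Qed.

Lemma mliftU c k : mlift << c *g k >> = c *: f k.
Proof. by rewrite malgUZ mliftZ mliftU1. Qed.

End LinearExtension.

(* The nonempty words, with the head stored separately: without the empty word,
   the algebra they span is the non-unital free one. *)
Section Words.
Variable X : choiceType.

Definition word : Type := (X * seq X)%type.
HB.instance Definition _ := Choice.on word.
Implicit Types u v w : word.

(** An embedding into plain lists, where identities between words reduce to those of [++] and
    [rev]. *)
Definition letters w : seq X := w.1 :: w.2.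
Definition wcat u v : word := (u.1, u.2 ++ letters v).
Definition wrev w : word := (last w.1 w.2, rev (belast w.1 w.2)).

Lemma letters_inj : injective letters.
Proof. by case=> [x s] [y t] [-> ->]. Qed.

Lemma letters_rev w : letters (wrev w) = rev (letters w).
Proof. by case: w => x s; rewrite /letters /= [in RHS]lastI rev_rcons. Qed.

Lemma wcatA : associative wcat.
Proof. by move=> u v w; apply: letters_inj; rewrite /letters /= -catA. Qed.

Lemma wrevK : involutive wrev.
Proof. by move=> w; apply: letters_inj; rewrite !letters_rev revK. Qed.

Lemma wrev_cat u v : wrev (wcat u v) = wcat (wrev v) (wrev u).
Proof.
apply: letters_inj; rewrite letters_rev.
have lcat u' v' : letters (wcat u' v') = letters u' ++ letters v' by [].
by rewrite !lcat rev_cat !letters_rev.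
Qed.

End Words.

Section FreeStarAlgebra.
Variables (C : numClosedFieldType) (X : choiceType).

Definition freeStar : Type := {malg C[word X]}.
HB.instance Definition _ := GRing.Lmodule.on freeStar.
Implicit Types a b c : freeStar.

Definition fs_mul a b : freeStar :=
  mlift (fun u => mlift (fun v => << wcat u v >> : freeStar) b : freeStar) a.
(** Conjugate-linear, hence not an instance of [mlift]. Words are only reversed, which makes the
    one-letter words self-adjoint. *)
Definition fs_star a : freeStar :=
  \sum_(k <- msupp a) << (a@_k)^* *g wrev k >>.

Lemma fs_mulDl : left_distributive fs_mul +%R.
Proof. by move=> a b c; exact: mliftD. Qed.

Lemma fs_mulZl (k : C) a b : fs_mul (k *: a) b = k *: fs_mul a b.
Proof. exact: mliftZ. Qed.

Lemma fs_mulDr : right_distributive fs_mul +%R.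
Proof.
move=> a b c; rewrite /fs_mul {1 2 4}/mlift -big_split.
by apply: eq_bigr => k _; rewrite [X in _ *: X]mliftD scalerDr.
Qed.

Lemma fs_mulZr (k : C) a b : fs_mul a (k *: b) = k *: fs_mul a b.
Proof.
rewrite /fs_mul {1 3}/mlift scaler_sumr; apply: eq_bigr => l _.
by rewrite [X in _ *: X]mliftZ !scalerA mulrC.
Qed.

Lemma fs_mulUU (c d : C) u v :
  fs_mul << c *g u >> << d *g v >> = << c * d *g wcat u v >>.
Proof. by rewrite /fs_mul !mliftU scalerA -malgUZ. Qed.

(** Additivity in each argument in turn reduces the claim to monomials, where it is associativity of
    concatenation. *)
Lemma fs_mulA : associative fs_mul.
Proof.
move=> a b c; move: a; apply: (malg_additive_ext
  (F1 := fun a => fs_mul a (fs_mul b c))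
  (F2 := fun a => fs_mul (fs_mul a b) c)).
- by move=> x y; rewrite fs_mulDl.
- by move=> x y; rewrite [fs_mul (x + y) b]fs_mulDl fs_mulDl.
move=> k u; move: b; apply: (malg_additive_ext
  (F1 := fun b => fs_mul << k *g u >> (fs_mul b c))
  (F2 := fun b => fs_mul (fs_mul << k *g u >> b) c)).
- by move=> x y; rewrite [fs_mul (x + y) c]fs_mulDl fs_mulDr.
- by move=> x y; rewrite [fs_mul _ (x + y)]fs_mulDr fs_mulDl.
move=> l v; move: c; apply: (malg_additive_ext
  (F1 := fun c => fs_mul << k *g u >> (fs_mul << l *g v >> c))
  (F2 := fun c => fs_mul (fs_mul << k *g u >> << l *g v >>) c)).
- by move=> x y; rewrite [fs_mul _ (x + y)]fs_mulDr fs_mulDr.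
- by move=> x y; rewrite fs_mulDr.
by move=> m w; rewrite !fs_mulUU wcatA mulrA.
Qed.

(** Reversal is a bijection of words, so at most one monomial of the sum contributes to a given
    coefficient. *)
Lemma mcoeff_star a w : (fs_star a)@_w = (a@_(wrev w))^*.
Proof.
rewrite /fs_star raddf_sum /=.
under eq_bigr => k _ do rewrite mcoeffU (can2_eq (@wrevK X) (@wrevK X)).
case: (boolP (wrev w \in msupp a)) => [i|ni].
  rewrite (big_fsetD1 _ i) /= eqxx mulr1n big1_fset ?addr0 // => k.
  by rewrite !inE => /andP[/negPf-> _].
rewrite (mcoeff_outdom ni) rmorph0 big1_fset // => k ik _.
by case: eqP => // e; rewrite -e ik in ni.
Qed.

Lemma fs_starK : involutive fs_star.
Proof. by move=> a; apply/malgP => w; rewrite !mcoeff_star wrevK conjCK. Qed.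

Lemma fs_starD : {morph fs_star : a b / a + b}.
Proof.
by move=> a b; apply/malgP => w; rewrite !(mcoeff_star, mcoeffD) rmorphD.
Qed.

Lemma fs_starZ (k : C) a : fs_star (k *: a) = k^* *: fs_star a.
Proof.
by apply/malgP => w; rewrite !(mcoeff_star, mcoeffZ) rmorphM.
Qed.

Lemma fs_starU (c : C) u : fs_star << c *g u >> = << c^* *g wrev u >>.
Proof.
apply/malgP => w; rewrite mcoeff_star !mcoeffU (can2_eq (@wrevK X) (@wrevK X)).
by rewrite rmorphMn.
Qed.

Lemma fs_starM a b : fs_star (fs_mul a b) = fs_mul (fs_star b) (fs_star a).
Proof.
move: a.
apply: malg_additive_ext => [x y|x y|k u];
  rewrite ?(fs_mulDl, fs_mulDr, fs_starD, fs_mulDr) //.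
move: b.
apply: malg_additive_ext => [x y|x y|l v];
  rewrite ?(fs_mulDl, fs_mulDr, fs_starD, fs_mulDl) //.
by rewrite !(fs_mulUU, fs_starU) wrev_cat rmorphM mulrC.
Qed.

HB.instance Definition _ := isStarAlgebra.Build C freeStar
  fs_mulA fs_mulDl fs_mulDr fs_mulZl fs_mulZr
  fs_starK fs_starD fs_starZ fs_starM.

Definition gen (x : X) : freeStar := << (x, [::]) >>.

Lemma star_gen x : star (gen x) = gen x.
Proof. by rewrite /star /= fs_starU rmorph1. Qed.

End FreeStarAlgebra.

Arguments gen {C X}.

Section StarHom.
Variables (C : numClosedFieldType) (A B D : starAlgType C).

Lemma star_hom_comp (f : A -> B) (g : B -> D) :
  star_hom f -> star_hom g -> star_hom (g \o f).
Proof.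
move=> [lf mf sf] [lg mg sg]; split=> [a x y|x y|x] /=.
- by rewrite lf lg.
- by rewrite mf mg.
- by rewrite sf sg.
Qed.

Lemma star_homD (f : A -> B) : star_hom f -> {morph f : x y / x + y}.
Proof. by case=> l _ _ x y; have := l 1 x y; rewrite !scale1r. Qed.

Lemma star_homZ (f : A -> B) k x : star_hom f -> f (k *: x) = k *: f x.
Proof.
move=> hf; have f0 : f 0 = 0.
  by apply: (@addrI _ (f 0)); rewrite -(star_homD hf) !addr0.
by case: hf => l _ _; have := l k x 0; rewrite f0 !addr0.
Qed.

End StarHom.

(** * Universal property of the free *-algebra *)

Section Evaluation.
Variables (C : numClosedFieldType) (X : choiceType) (D : starAlgType C).

(** Every word is a product of generators, obtained by appending one letter at a time on the
    right. *)
Lemma freeStar_hom_ext (f g : freeStar C X -> D) :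
  star_hom f -> star_hom g -> (forall x, f (gen x) = g (gen x)) -> f = g.
Proof.
move=> hf hg e; apply/funext/malg_additive_ext.
- exact: (star_homD hf).
- exact: (star_homD hg).
move=> c [x s]; rewrite malgUZ (star_homZ _ _ hf) (star_homZ _ _ hg).
congr (_ *: _); elim/last_ind: s => [|s y IH]; first exact: e.
have -> : << (x, rcons s y) >> = smul (<< (x, s) >> : freeStar C X) (gen y).
  by rewrite /smul /= fs_mulUU mulr1 /wcat /= cats1.
by have [[_ -> _] [_ -> _]] := (hf, hg); rewrite IH e.
Qed.

Variable s : X -> D.
Hypothesis s_star : forall x, star (s x) = s x.

(** The fold starts from the value of the head letter because [D] need not have a unit. *)
Definition weval (w : word X) : D :=
  foldl (fun d y => smul d (s y)) (s w.1) w.2.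

Lemma weval_rcons x t y : weval (x, rcons t y) = smul (weval (x, t)) (s y).
Proof. by rewrite /weval /= -cats1 foldl_cat. Qed.

Lemma weval_cat u v : weval (wcat u v) = smul (weval u) (weval v).
Proof.
case: v => y t; elim/last_ind: t => [|t z IH].
  by rewrite /wcat /letters /= cats1; case: u => x r; rewrite weval_rcons.
have -> : wcat u (y, rcons t z) = (u.1, rcons (wcat u (y, t)).2 z).
  by rewrite /wcat /= rcons_cat.
by rewrite !weval_rcons smulA -IH.
Qed.

Lemma weval_rev u : weval (wrev u) = star (weval u).
Proof.
case: u => x t; elim/last_ind: t => [|t y IH].
  by rewrite /weval /= s_star.
have -> : (x, rcons t y) = wcat (x, t) (y, [::]) by rewrite /wcat /= cats1.
by rewrite wrev_cat !weval_cat starM IH {1 3}/weval /= s_star.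
Qed.

Definition fs_lift (a : freeStar C X) : D := mlift weval a.

Lemma fs_lift_gen x : fs_lift (gen x) = s x.
Proof. exact: mliftU1. Qed.

Lemma fs_lift_hom : star_hom fs_lift.
Proof.
split; first exact: mlift_linear.
  move=> a b; move: a.
  apply: malg_additive_ext => [x y|x y|k u].
  - by rewrite smulDl /fs_lift mliftD.
  - by rewrite /fs_lift mliftD smulDl.
  move: b; apply: malg_additive_ext => [x y|x y|l v].
  - by rewrite smulDr /fs_lift mliftD.
  - by rewrite /fs_lift mliftD smulDr.
  rewrite {1}/smul /= fs_mulUU /fs_lift !mliftU weval_cat.
  by rewrite smulZl smulZr scalerA.
apply: malg_additive_ext => [x y|x y|k u].
- by rewrite starD /fs_lift mliftD.
- by rewrite /fs_lift mliftD starD.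
by rewrite {1}/star /= fs_starU /fs_lift !mliftU weval_rev starZ.
Qed.

End Evaluation.

(** * Coproducts of free *-algebras *)

Section FreeCoproduct.
Variables (C : numClosedFieldType) (X Y : choiceType).

Definition fs_inl : freeStar C X -> freeStar C (X + Y)%type :=
  fs_lift (fun x => gen (inl x)).
Definition fs_inr : freeStar C Y -> freeStar C (X + Y)%type :=
  fs_lift (fun y => gen (inr y)).

Lemma fs_inl_hom : star_hom fs_inl.
Proof. by apply: fs_lift_hom => x; rewrite star_gen. Qed.
Lemma fs_inr_hom : star_hom fs_inr.
Proof. by apply: fs_lift_hom => x; rewrite star_gen. Qed.
Lemma fs_inl_gen x : fs_inl (gen x) = gen (inl x).
Proof. exact: fs_lift_gen. Qed.
Lemma fs_inr_gen x : fs_inr (gen x) = gen (inr x).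
Proof. exact: fs_lift_gen. Qed.

(** A *-homomorphism out of a free *-algebra amounts to a choice of self-adjoint values on the
    generators, so a pair of them is one such choice on the disjoint union. *)
Lemma fs_coproduct : is_coproduct fs_inl fs_inr.
Proof.
split; [exact: fs_inl_hom|exact: fs_inr_hom|] => D f g hf hg.
pose s z := match z with inl x => f (gen x) | inr y => g (gen y) end.
have s_star z : star (s z) = s z.
  by case: z => x; rewrite /s;
    [case: hf|case: hg] => _ _ <-; rewrite star_gen.
have hs := fs_lift_hom s_star; exists (fs_lift s); split.
  split=> //; apply: freeStar_hom_ext => //.
  - exact: star_hom_comp fs_inl_hom hs.
  - by move=> x; rewrite /= fs_inl_gen fs_lift_gen.
  - exact: star_hom_comp fs_inr_hom hs.
  - by move=> x; rewrite /= fs_inr_gen fs_lift_gen.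
move=> h [hh ef eg]; apply: freeStar_hom_ext => //.
by case=> x; rewrite fs_lift_gen /s -?ef -?eg /= ?fs_inl_gen ?fs_inr_gen.
Qed.

Lemma star0 (A : starAlgType C) : star 0 = 0 :> A.
Proof. by apply: (@addrI _ (star 0)); rewrite -starD !addr0. Qed.

(** Sending the generators from [Y] to 0 and keeping those from [X] defines a left inverse. *)
Lemma fs_inl_inj : injective fs_inl.
Proof.
pose s (z : (X + Y)%type) : freeStar C X := if z is inl x then gen x else 0.
have hs : star_hom (fs_lift s).
  by apply: fs_lift_hom => -[x|y] /=; rewrite ?star_gen ?star0.
apply: (can_inj (g := fs_lift s)) => a.
rewrite -[LHS]/((fs_lift s \o fs_inl) a) -[RHS]/(id a).
congr (_ a); apply: freeStar_hom_ext.
- exact: star_hom_comp fs_inl_hom hs.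
- by split.
- by move=> x; rewrite /= fs_inl_gen fs_lift_gen.
Qed.

Lemma fs_inr_inj : injective fs_inr.
Proof.
pose s (z : (X + Y)%type) : freeStar C Y := if z is inr x then gen x else 0.
have hs : star_hom (fs_lift s).
  by apply: fs_lift_hom => -[x|y] /=; rewrite ?star_gen ?star0.
apply: (can_inj (g := fs_lift s)) => a.
rewrite -[LHS]/((fs_lift s \o fs_inr) a) -[RHS]/(id a).
congr (_ a); apply: freeStar_hom_ext.
- exact: star_hom_comp fs_inr_hom hs.
- by split.
- by move=> x; rewrite /= fs_inr_gen fs_lift_gen.
Qed.

Definition free_coproduct : coproduct (freeStar C X) (freeStar C Y) :=
  Coproduct fs_coproduct.
Definition free_twoFaced : twoFaced C :=
  TwoFaced fs_inl_inj fs_inr_inj fs_coproduct.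

End FreeCoproduct.

(** * Invariance under a common phase *)

Section Twist.
Variables (C : numClosedFieldType) (H : preHilbertType C).
Local Notation P := (POmega H).
Local Notation Q := (Pperp H).
Implicit Types (h k : H) (X : La H).

Lemma La_sub X h k : X (h - k) = X h - X k.
Proof. by rewrite La_add -[- k]scaleN1r La_scale scaleN1r. Qed.

Lemma La_0 X : X 0 = 0.
Proof. by apply: (@addrI _ (X 0)); rewrite -La_add !addr0. Qed.

Lemma POmegaE h : P h = inner Omega h *: (Omega : H). Proof. by []. Qed.
Lemma PperpE h : Q h = h - P h.
Proof. by []. Qed.

Lemma PP h : P (P h) = P h.
Proof. by rewrite !POmegaE innerZr inner_Omega mulr1. Qed.
Lemma QP h : Q (P h) = 0. Proof. by rewrite PperpE PP subrr. Qed.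
Lemma PQ h : P (Q h) = 0. Proof. by rewrite PperpE La_sub PP subrr. Qed.
Lemma QQ h : Q (Q h) = Q h. Proof. by rewrite PperpE PQ subr0. Qed.
Lemma PDQ h : P h + Q h = h. Proof. by rewrite PperpE addrC subrK. Qed.
Lemma POmega_Omega : P Omega = Omega.
Proof. by rewrite POmegaE inner_Omega scale1r. Qed.
Lemma Pperp_Omega : Q Omega = 0.
Proof. by rewrite PperpE POmega_Omega subrr. Qed.

Definition pqE := (PP, QP, PQ, QQ).

Lemma star_POmega : La_star P = P.
Proof.
apply: La_star_uniq => h k.
by rewrite !POmegaE innerZr innerZl -inner_conj mulrC.
Qed.

Lemma star_La_id : La_star (La_id H) = La_id H.
Proof. exact: La_star_uniq. Qed.

Lemma star_Pperp : La_star Q = Q.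
Proof.
rewrite /Pperp La_starD star_La_id -scaleN1r La_starZ star_POmega.
by rewrite rmorphN rmorph1.
Qed.

Lemma twistE g X h : twist g X h =
  `|g| *: P (X (P h)) + g^* *: P (X (Q h))
  + g *: Q (X (P h)) + `|g| *: Q (X (Q h)).
Proof. by []. Qed.

Definition rot (u : C) : La H := P + u *: Q.

Lemma rotE u h : rot u h = P h + u *: Q h. Proof. by []. Qed.

Lemma star_rot u : La_star (rot u) = rot u^*.
Proof. by rewrite La_starD La_starZ star_POmega star_Pperp. Qed.

Lemma POmega_rot u h : P (rot u h) = P h.
Proof. by rewrite rotE La_add PP [P (u *: _)]La_scale PQ scaler0 addr0. Qed.
Lemma Pperp_rot u h : Q (rot u h) = u *: Q h.
Proof. by rewrite rotE La_add QP [Q (u *: _)]La_scale QQ add0r. Qed.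

Lemma rot_rot u v h : rot u (rot v h) = rot (u * v) h.
Proof. by rewrite rotE POmega_rot Pperp_rot scalerA. Qed.

Lemma rot1 h : rot 1 h = h.
Proof. by rewrite rotE scale1r PDQ. Qed.

(** The off-diagonal blocks acquire the factors [u] and [u^*]; the diagonal blocks stay fixed
    because [u * u^* = 1], in agreement with [|u g| = |g|]. *)
Lemma rot_twist u g X h : `|u| = 1 ->
  rot u (twist g X (rot u^* h)) = twist (u * g) X h.
Proof.
move=> u1; have uu : u * u^* = 1 by rewrite -normCK u1 expr1n.
rewrite rotE !twistE POmega_rot Pperp_rot normrM u1 mul1r rmorphM.
(* Abstracting the projections keeps [La_add] and [La_scale] from matching
   their unfoldings. *)
move: (POmega H) (Pperp H) PP PQ QP QQ => p q pp pq qp qq.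
rewrite !(La_add, La_scale) !(pp, pq, qp, qq) !(scaler0, addr0, add0r).
rewrite !scalerDr !scalerA !addrA.
by rewrite [u * (_ * _)]mulrCA uu mulr1 [g^* * _]mulrC.
Qed.

End Twist.

(** * Conjugation of the lifts by a unitary of the tensor product *)

Section Conjugation.
Variables (C : numClosedFieldType) (H G : preHilbertType C).
Variable K : tensorProduct H G.

Lemma tenDl h h' g : ten K (h + h') g = ten K h g + ten K h' g.
Proof. by have := (ten_bilinear K).2 g 1 h h'; rewrite !scale1r. Qed.
Lemma tenDr h g g' : ten K h (g + g') = ten K h g + ten K h g'.
Proof. by have := (ten_bilinear K).1 h 1 g g'; rewrite !scale1r. Qed.
Lemma ten0l g : ten K 0 g = 0.
Proof. by apply: (@addrI _ (ten K 0 g)); rewrite -tenDl !addr0. Qed.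
Lemma ten0r h : ten K h 0 = 0.
Proof. by apply: (@addrI _ (ten K h 0)); rewrite -tenDr !addr0. Qed.
Lemma tenZl a h g : ten K (a *: h) g = a *: ten K h g.
Proof. by have := (ten_bilinear K).2 g a h 0; rewrite ten0l !addr0. Qed.
Lemma tenZr a h g : ten K h (a *: g) = a *: ten K h g.
Proof. by have := (ten_bilinear K).1 h a g 0; rewrite ten0r !addr0. Qed.

Lemma ten_opE X Y h g : ten_op K X Y (ten K h g) = ten K (X h) (Y g).
Proof. exact: ten_funE. Qed.

Lemma ten_La_ext (Z Z' : La K) :
  (forall h g, Z (ten K h g) = Z' (ten K h g)) -> Z = Z'.
Proof.
by move=> e; apply: LaP; apply/funeqP/ten_ext => //; exact: La_linear.
Qed.

Lemma star_ten_op X Y :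
  La_star (ten_op K X Y) = ten_op K (La_star X) (La_star Y).
Proof. by apply: La_star_uniq; exact: ten_fun_adjoint. Qed.

Lemma left_liftE c X h g : left_lift K c X (ten K h g) =
  ten K (X h) (POmega G g) + ten K (twist c X h) (Pperp G g).
Proof. by rewrite LaDE !ten_opE. Qed.

Lemma right_liftE d Y h g : right_lift K d Y (ten K h g) =
  ten K (POmega H h) (Y g) + ten K (Pperp H h) (twist d Y g).
Proof. by rewrite LaDE !ten_opE. Qed.

(* Multiplication by [u] on the orthogonal complement of
   [H (x) Omega + Omega (x) G], and the identity on that sum. *)
Definition twirl (u : C) : La K :=
  ten_op K (La_id H) (POmega G) + ten_op K (rot H u) (Pperp G).

Lemma twirlEl u h g : twirl u (ten K h g) =
  ten K h (POmega G g) + ten K (rot H u h) (Pperp G g).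
Proof. by rewrite LaDE !ten_opE. Qed.

(** The twirl is symmetric in the two factors, since its only nontrivial action is on complement
    tensor complement. This form, with the rotation on the right factor, serves the right lifts. *)
Lemma twirlEr u h g : twirl u (ten K h g) =
  ten K (POmega H h) g + ten K (Pperp H h) (rot G u g).
Proof.
have -> : ten K (POmega H h) g =
    ten K (POmega H h) (POmega G g) + ten K (POmega H h) (Pperp G g).
  by rewrite -tenDr PDQ.
rewrite twirlEl !rotE -{1}(PDQ h).
move: (POmega H h) (Pperp H h) (POmega G g) (Pperp G g) => h1 h2 g1 g2.
by rewrite !(tenDl, tenDr, tenZl, tenZr) addrACA.
Qed.

Lemma star_twirl u : La_star (twirl u) = twirl u^*.
Proof.
by rewrite La_starD !star_ten_op star_La_id star_POmega star_rot star_Pperp.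
Qed.

Lemma twirl_Omega u : twirl u Omega = Omega.
Proof. by rewrite -ten_Omega twirlEl POmega_Omega Pperp_Omega ten0r addr0. Qed.

Variable u : C.
Hypothesis u1 : `|u| = 1.

Let uu : u^* * u = 1. Proof. by rewrite mulrC -normCK u1 expr1n. Qed.

Lemma twirlK x : twirl u^* (twirl u x) = x.
Proof.
suff e : La_comp (twirl u^*) (twirl u) = La_id K.
  by rewrite -La_compE e.
apply: ten_La_ext => h g; rewrite La_compE twirlEl La_add !twirlEl !pqE.
by rewrite !ten0r addr0 add0r rot_rot uu rot1 -tenDr PDQ.
Qed.

Definition twirl_conj (Z : La K) : La K :=
  La_comp (twirl u) (La_comp Z (twirl u^*)).

(** Where the right factor is a multiple of [Omega] the twirl is the identity; where it is
    orthogonal to [Omega] the twirl rotates the left factor. So only the twisted summand changes, by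
    [rot_twist]. *)
Lemma twirl_left_lift c X :
  twirl_conj (left_lift K c X) = left_lift K (u * c) X.
Proof.
apply: ten_La_ext => h g; rewrite !La_compE twirlEl.
rewrite [left_lift K c X _]La_add !left_liftE !pqE.
rewrite !ten0r addr0 add0r La_add !twirlEl !pqE !ten0r addr0 add0r.
by rewrite rot_twist.
Qed.

Lemma twirl_right_lift d Y :
  twirl_conj (right_lift K d Y) = right_lift K (u * d) Y.
Proof.
apply: ten_La_ext => h g; rewrite !La_compE twirlEr.
rewrite [right_lift K d Y _]La_add !right_liftE !pqE.
rewrite !ten0l addr0 add0r La_add !twirlEr !pqE !ten0l addr0 add0r.
by rewrite rot_twist.
Qed.

Lemma twirl_conj_hom (P : starAlgType C) (Pi : P -> La K) :
  star_hom Pi -> star_hom (twirl_conj \o Pi).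
Proof.
move=> [lP mP sP]; split=> [a x y|x y|x] /=.
- rewrite /twirl_conj lP; move: (twirl u) (twirl u^*) => w w'.
  by rewrite La_compDl La_compDr La_compZl La_compZr.
- by apply: LaP => h; rewrite mP !La_compE twirlK.
rewrite sP -[RHS]/(La_star (twirl_conj (Pi x))) /twirl_conj !La_starM.
by rewrite !star_twirl conjCK La_compA.
Qed.

Lemma twirl_conj_vacuum (Z : La K) :
  inner Omega (twirl_conj Z Omega) = inner Omega (Z Omega).
Proof. by rewrite !La_compE La_starP star_twirl !twirl_Omega. Qed.

End Conjugation.

Definition scale_params (C : numClosedFieldType) (u : C) (p : lift_params C) :=
  TT (u * gamma1 p) (u * delta1 p) (u * gamma2 p) (u * delta2 p).

Section Coincide.
Variable C : numClosedFieldType.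

Lemma is_product_scale (u : C) p (A B : twoFaced C) (P : coproduct A B) phi psi
    (theta : P -> C) : circle u ->
  is_product p phi psi theta -> is_product (scale_params u p) phi psi theta.
Proof.
move=> u1 [H [G [K [pi [sigma [Pi [rpi [rsi [hP [e1 [e2 [e3 [e4 et]]]]]]]]]]]]].
exists H, G, K, pi, sigma, (twirl_conj u \o Pi).
do 2![split; first by []]; split; first exact: twirl_conj_hom.
do 4![split; first by move=> x /=;
  rewrite ?e1 ?e2 ?e3 ?e4 (twirl_left_lift, twirl_right_lift)].
by move=> c; rewrite /= twirl_conj_vacuum.
Qed.

Lemma scale_paramsK (u : C) p : circle u ->
  scale_params u^* (scale_params u p) = p.
Proof.
move=> u1; have uu : u^* * u = 1 by rewrite mulrC -normCK u1 expr1n.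
by case: p => *; rewrite /scale_params /= !mulrA uu !mul1r.
Qed.

Lemma coincide_scale (u : C) p : circle u -> coincide p (scale_params u p).
Proof.
move=> u1 A B P phi psi _ _ theta; split; first exact: is_product_scale.
(* The converse is scaling back by the inverse phase [u^*]. *)
move=> /(@is_product_scale u^*); rewrite scale_paramsK //; apply.
by rewrite /circle norm_conjC.
Qed.

End Coincide.

(** * Lifts as *-homomorphisms and moments of the product *)

Section LiftHom.
Variable C : numClosedFieldType.

(** These are the relations behind multiplicativity of [twist c]: the coefficients of two composed
    blocks must multiply to the coefficient of the resulting block. *)
Lemma circle0P (c : C) : circle c \/ c = 0 ->
  [/\ `|c| * `|c| = `|c|, `|c| * c = c & c^* * c = `|c|].
Proof.
case=> [c1|->]; last by rewrite normr0 !mulr0.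
by rewrite [c^* * c]mulrC -normCK c1 !mul1r expr1n.
Qed.

Section TwistHom.
Variables (H : preHilbertType C) (c : C).
Hypothesis hc : circle c \/ c = 0.

Lemma star_twist (X : La H) : La_star (twist c X) = twist c (La_star X).
Proof.
apply: La_star_uniq => h k; rewrite !twistE.
have sP := star_POmega H; have sQ := star_Pperp H.
move: (POmega H) (Pperp H) sP sQ => p q sp sq.
rewrite !(innerDr, innerDl) !(innerZr, innerZl).
rewrite !La_starP !sp !sq conjCK.
by rewrite !conj_normC; congr (_ + _); rewrite addrAC.
Qed.

Lemma twist_hom : star_hom (@twist C H c).
Proof.
have [cc cm mc] := circle0P hc.
split=> [a X Y|X Y|X]; last by rewrite [RHS]star_twist.
  apply: LaP => h; rewrite -[RHS]/(a *: twist c X h + twist c Y h) !twistE.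
  move: (POmega H) (Pperp H) => p q.
  rewrite !(LaDE, LaZE) !(La_add, La_scale) !scalerDr !scalerA.
  rewrite ![a * _]mulrC.
  by rewrite [LHS](AC (2*2*2*2) ((1*3*5*7)*(2*4*6*8))).
apply: LaP => h; rewrite La_compE !twistE.
(* Inserting the identity as [POmega + Pperp] between [X] and [Y] expands the composition as a
   product of block matrices. *)
have d k : X k = X (POmega H k) + X (Pperp H k) by rewrite -La_add PDQ.
rewrite !La_compE (d (Y (POmega H h))) (d (Y (Pperp H h))).
move: (POmega H) (Pperp H) (@PP _ H) (@PQ _ H) (@QP _ H) (@QQ _ H) d.
move=> p q pp pq qp qq _.
rewrite !(La_add, La_scale) !(pp, pq, qp, qq) !(La_0, scaler0, addr0, add0r).
rewrite !scalerDr !scalerA.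
have cmc : `|c| * c^* = c^*.
  by have := congr1 Num.conj cm; rewrite rmorphM /= conj_normC.
rewrite [c^* * `|c|]mulrC [c * `|c|]mulrC [c * c^*]mulrC mc cmc cc cm.
by rewrite [LHS](AC (2*2*2*2) (((1*3)*(2*4))*(5*7)*(6*8))).
Qed.

End TwistHom.

Variables (H G : preHilbertType C) (K : tensorProduct H G) (c : C).
Hypothesis hc : circle c \/ c = 0.

(** The two summands have mutually orthogonal projections on the right factor, so mixed products
    vanish, and each summand is a *-homomorphism in [X] by itself. *)
Lemma left_lift_hom : star_hom (@left_lift C H G K c).
Proof.
have [tl tm ts] := twist_hom H hc.
split=> [a X Y|X Y|X].
- apply: ten_La_ext => h g.
  rewrite -[RHS]/(a *: left_lift K c X (ten K h g) +
    left_lift K c Y (ten K h g)).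
  rewrite !left_liftE tl; move: (twist c X) (twist c Y) => X' Y'.
  rewrite !(LaDE, LaZE).
  by rewrite !(tenDl, tenZl) scalerDr addrACA.
- apply: ten_La_ext => h g.
  rewrite -[RHS]/(left_lift K c X (left_lift K c Y (ten K h g))) !left_liftE.
  by rewrite [RHS]La_add !left_liftE !pqE !ten0r addr0 add0r tm.
- by rewrite /left_lift ts [RHS]La_starD !star_ten_op star_POmega star_Pperp.
Qed.

Lemma right_lift_hom : star_hom (@right_lift C H G K c).
Proof.
have [tl tm ts] := twist_hom G hc.
split=> [a X Y|X Y|X].
- apply: ten_La_ext => h g.
  rewrite -[RHS]/(a *: right_lift K c X (ten K h g) +
    right_lift K c Y (ten K h g)).
  rewrite !right_liftE tl; move: (twist c X) (twist c Y) => X' Y'.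
  rewrite !(LaDE, LaZE).
  by rewrite !(tenDr, tenZr) scalerDr addrACA.
- apply: ten_La_ext => h g.
  rewrite -[RHS]/(right_lift K c X (right_lift K c Y (ten K h g))) !right_liftE.
  by rewrite [RHS]La_add !right_liftE !pqE !ten0l addr0 add0r tm.
- by rewrite /right_lift ts [RHS]La_starD !star_ten_op star_POmega star_Pperp.
Qed.

End LiftHom.

(** * Action of one and two lifts on the vacuum vector *)

Section VacuumVectors.
Variables (C : numClosedFieldType) (H G : preHilbertType C).
Variable K : tensorProduct H G.

Lemma right_lift_vacuum d Y : right_lift K d Y Omega = ten K Omega (Y Omega).
Proof.
by rewrite -ten_Omega right_liftE POmega_Omega Pperp_Omega ten0l addr0.
Qed.

Lemma left_lift_vacuum c X : left_lift K c X Omega = ten K (X Omega) Omega.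
Proof.
by rewrite -ten_Omega left_liftE POmega_Omega Pperp_Omega ten0r addr0.
Qed.

Lemma POmega_eq0 (L : preHilbertType C) (v : L) :
  inner Omega v = 0 -> (POmega L v = 0) * (Pperp L v = v).
Proof. by move=> v0; rewrite PperpE POmegaE v0 scale0r subr0. Qed.

(** Only the block from [Omega] to its complement contributes, and its coefficient is [c] with its
    phase. *)
Lemma twist_vacuum (L : preHilbertType C) c (X : La L) :
  inner Omega (X Omega) = 0 -> twist c X Omega = c *: X Omega.
Proof.
move=> /POmega_eq0 [PX QX]; rewrite twistE POmega_Omega Pperp_Omega PX QX.
by rewrite !La_0 !scaler0 !addr0 add0r.
Qed.

(** The lift that acts first leaves no trace of its parameter. It makes its own factor orthogonal to
    [Omega], so that the second lift acts through its twist. *)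
Lemma left_right_vacuum c d (X : La H) (Y : La G) :
  inner Omega (X Omega) = 0 -> inner Omega (Y Omega) = 0 ->
  left_lift K c X (right_lift K d Y Omega) = c *: ten K (X Omega) (Y Omega).
Proof.
move=> X0 Y0; rewrite right_lift_vacuum left_liftE !(POmega_eq0 Y0) ten0r add0r.
by rewrite twist_vacuum // tenZl.
Qed.

Lemma right_left_vacuum c d (X : La H) (Y : La G) :
  inner Omega (X Omega) = 0 -> inner Omega (Y Omega) = 0 ->
  right_lift K d Y (left_lift K c X Omega) = d *: ten K (X Omega) (Y Omega).
Proof.
move=> X0 Y0; rewrite left_lift_vacuum right_liftE !(POmega_eq0 X0) ten0l add0r.
by rewrite twist_vacuum // tenZr.
Qed.

End VacuumVectors.

Lemma inner_star_smul (C : numClosedFieldType) (H : preHilbertType C)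
    (X Y : La H) h :
  inner h (smul (star X) Y h) = inner (X h) (Y h).
Proof. by rewrite -[LHS]/(inner h (La_star X (Y h))) La_starP La_starK. Qed.

Section ProductMoments.
Variables (C : numClosedFieldType) (p : lift_params C).
Variables (A B : twoFaced C) (P : coproduct A B).
Variables (phi : A -> C) (psi : B -> C) (theta : P -> C).
Variables (x1 : face1 A) (x2 : face2 A) (y1 : face1 B) (y2 : face2 B).

Definition lift_coord (l i : bool) : C :=
  match l, i with
  | true, true => gamma1 p | true, false => gamma2 p
  | false, true => delta1 p | false, false => delta2 p
  end.

Let x (i : bool) : A := if i then incl1 x1 else incl2 x2.
Let y (i : bool) : B := if i then incl1 y1 else incl2 y2.

(** The letter acting first on [Omega] is always taken from face 1: its parameter does not enter, so
    each word detects exactly the parameter of its outer letter. *)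
Definition test_word (l i : bool) : P :=
  if l then smul (cop_inl P (x i)) (cop_inr P (y true))
  else smul (cop_inr P (y i)) (cop_inl P (x true)).

Hypothesis theta_prod : is_product p phi psi theta.
Hypothesis phi0 : forall i, phi (x i) = 0.
Hypothesis psi0 : forall i, psi (y i) = 0.
Hypothesis phi1 : forall i j, phi (smul (star (x i)) (x j)) = 1.
Hypothesis psi1 : forall i j, psi (smul (star (y i)) (y j)) = 1.

(** Each test word maps [Omega] to its parameter times an elementary tensor. The moments [phi1] and
    [psi1], mixed faces included, make all inner products of these tensors equal to 1. *)
Lemma product_moments l i m j :
  theta (smul (star (test_word l i)) (test_word m j)) =
  (lift_coord l i)^* * lift_coord m j.
Proof.
have [H [G [K [pi [sigma [Pi [[hpi rpi] [[hsi rsi] [hPi]]]]]]]]] := theta_prod.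
move=> [e1 [e2 [e3 [e4 et]]]].
have piM a b : phi (smul (star a) b) = inner (pi a Omega) (pi b Omega).
  by case: hpi => _ hM hS; rewrite rpi hM hS inner_star_smul.
have siM a b : psi (smul (star a) b) = inner (sigma a Omega) (sigma b Omega).
  by case: hsi => _ hM hS; rewrite rsi hM hS inner_star_smul.
have PiM a b : theta (smul (star a) b) = inner (Pi a Omega) (Pi b Omega).
  by case: hPi => _ hM hS; rewrite et hM hS inner_star_smul.
have px i' : Pi (cop_inl P (x i')) =
    left_lift K (lift_coord true i') (pi (x i')).
  by case: i'; rewrite /x ?e1 ?e2.
have py i' : Pi (cop_inr P (y i')) =
    right_lift K (lift_coord false i') (sigma (y i')).
  by case: i'; rewrite /y ?e3 ?e4.
have x0 i' : inner Omega (pi (x i') Omega) = 0 by rewrite -rpi.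
have y0 i' : inner Omega (sigma (y i') Omega) = 0 by rewrite -rsi.
pose i1 l' i' := if l' then i' else true.
pose i2 (l' i' : bool) := if l' then true else i'.
have wE l' i' : Pi (test_word l' i') Omega = lift_coord l' i' *:
    ten K (pi (x (i1 l' i')) Omega) (sigma (y (i2 l' i')) Omega).
  case: hPi => _ hM _; case: l'; rewrite /test_word hM px py.
    exact: left_right_vacuum.
  exact: right_left_vacuum.
rewrite PiM !wE innerZr innerZl ten_inner -piM -siM phi1 psi1 !mulr1.
by rewrite mulrC.
Qed.

End ProductMoments.

(** The unital extension at [u^* u] is the squared norm of the vector
    [u.1 *: Omega + pi u.2 Omega]. *)
Lemma represents_state (C : numClosedFieldType) (A : starAlgType C)
    (H : preHilbertType C) (pi : A -> La H) (phi : A -> C) :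
  represents pi phi -> state phi.
Proof.
move=> [hpi rp]; have [lp mp sp] := hpi; split=> [a x y|u].
  by rewrite !rp lp -inner_linear.
have phiD : {morph phi : v w / v + w}.
  by move=> v w; rewrite !rp (star_homD hpi) -innerDr.
have phiZ k v : phi (k *: v) = k * phi v.
  by rewrite !rp (star_homZ _ _ hpi) -innerZr.
suff -> : unital_extension phi (smul (star u) u) =
    inner (u.1 *: Omega + pi u.2 Omega) (u.1 *: Omega + pi u.2 Omega).
  exact: inner_ge0.
rewrite /unital_extension /= !phiD !phiZ !rp mp sp inner_star_smul.
rewrite innerDl !innerDr !innerZr !innerZl inner_Omega mulr1.
rewrite -[star (pi u.2) Omega]/(La_star (pi u.2) Omega).
rewrite [inner Omega (La_star _ _)]La_starP La_starK.
by rewrite mulrC !addrA.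
Qed.

(** * Finite-dimensional pre-Hilbert spaces and their tensor products *)

Section L2.
Variables (C : numClosedFieldType) (I : finType).

(** The type carries [i0] so that its pre-Hilbert structure can take [l2_delta i0] as the unit
    vector. *)
Definition l2 (i0 : I) : Type := {ffun I -> C^o}.
Variable i0 : I.
HB.instance Definition _ := GRing.Lmodule.on (l2 i0).

Definition l2_inner (f g : l2 i0) : C := \sum_i (f i)^* * g i.
Definition l2_delta (j : I) : l2 i0 := [ffun i => (i == j)%:R].

Lemma l2_innerE (j : I) f : l2_inner (l2_delta j) f = f j.
Proof.
rewrite /l2_inner (bigD1 j) //= ffunE eqxx rmorph1 mul1r big1 ?addr0 // => i.
by rewrite ffunE => /negPf->; rewrite rmorph0 mul0r.
Qed.

Fact l2_inner_linear f : linear (l2_inner f : l2 i0 -> C^o).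
Proof.
move=> a g h; rewrite /l2_inner scaler_sumr -big_split; apply: eq_bigr => i _.
by rewrite /= !ffunE mulrDr mulrCA.
Qed.

Fact l2_inner_conj f g : l2_inner g f = (l2_inner f g)^*.
Proof.
rewrite /l2_inner rmorph_sum; apply: eq_bigr => i _.
by rewrite /= rmorphM /= conjCK mulrC.
Qed.

Fact l2_inner_ge0 f : 0 <= l2_inner f f.
Proof. by apply: sumr_ge0 => i _; rewrite mulrC mul_conjC_ge0. Qed.

Fact l2_inner_eq0 f : l2_inner f f = 0 -> f = 0.
Proof.
have ge0 i : true -> 0 <= (f i)^* * f i by rewrite mulrC mul_conjC_ge0.
move=> /(psumr_eq0P ge0) f0; apply/ffunP => i; rewrite ffunE; apply/eqP.
by rewrite -mul_conjC_eq0 mulrC f0.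
Qed.

Fact l2_inner_Omega : l2_inner (l2_delta i0) (l2_delta i0) = 1.
Proof. by rewrite l2_innerE ffunE eqxx. Qed.

HB.instance Definition _ := isPreHilbert.Build C (l2 i0)
  l2_inner_linear l2_inner_conj l2_inner_ge0 l2_inner_eq0 l2_inner_Omega.

Lemma l2_sum_delta (f : l2 i0) : f = \sum_i (f i : C) *: l2_delta i.
Proof.
apply/ffunP => j; rewrite sum_ffunE (bigD1 j) //= !ffunE eqxx.
rewrite [_ *: _]mulr1 big1 ?addr0 // => i ij.
by rewrite !ffunE eq_sym (negPf ij) scaler0.
Qed.

Lemma linear_sumZ (U V : lmodType C) (F : U -> V) (J : finType) (a : J -> C)
    (v : J -> U) : linear F -> F (\sum_j a j *: v j) = \sum_j a j *: F (v j).
Proof.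
move=> lF; have FD : {morph F : x y / x + y}.
  by move=> x y; have := lF 1 x y; rewrite !scale1r.
have F0 : F 0 = 0 by apply: (@addrI _ (F 0)); rewrite -FD !addr0.
rewrite (big_morph F FD F0); apply: eq_bigr => j _.
by have := lF (a j) (v j) 0; rewrite F0 !addr0.
Qed.

Section Permutation.
Variable s : I -> I.
Hypothesis sK : involutive s.

Fact l2_perm_subproof :
  (fun f : l2 i0 => [ffun i => f (s i)] : l2 i0) \in @adjointable C (l2 i0).
Proof.
have lin : linear (fun f : l2 i0 => [ffun i => f (s i)] : l2 i0).
  by move=> a f g; apply/ffunP => i; rewrite !ffunE.
apply/asboolP; split=> //.
exists (fun f : l2 i0 => [ffun i => f (s i)] : l2 i0).
split=> // f g; rewrite /inner /= /l2_inner (reindex_inj (can_inj sK)) /=.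
by apply: eq_bigr => i _; rewrite !ffunE sK.
Qed.
Definition l2_perm : La (l2 i0) := MkLa l2_perm_subproof.

Lemma star_l2_perm : star l2_perm = l2_perm.
Proof.
apply: La_star_uniq => f g.
rewrite /inner /= /l2_inner (reindex_inj (can_inj sK)) /=.
by apply: eq_bigr => i _; rewrite !ffunE sK.
Qed.

Lemma l2_perm_delta j : l2_perm (l2_delta j) = l2_delta (s j).
Proof. by apply/ffunP => i; rewrite !ffunE (can2_eq sK sK). Qed.

End Permutation.
End L2.

Section L2Tensor.
Variables (C : numClosedFieldType) (I J : finType) (i0 : I) (j0 : J).
Local Notation H := (l2 C i0).
Local Notation G := (l2 C j0).
Local Notation K := (l2 C (i0, j0)).

Definition l2_ten (f : H) (g : G) : K := [ffun p => f p.1 * g p.2].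

Lemma l2_ten_bilinear : bilinear_map l2_ten.
Proof.
split=> [f a g g'|g a f f']; apply/ffunP => p; rewrite !ffunE.
  by rewrite mulrDr [f _ * (_ *: _)]mulrCA.
by rewrite mulrDl -[a *: f p.1 * _]mulrA.
Qed.

Lemma l2_ten_delta (p : I * J) :
  l2_ten (l2_delta C i0 p.1) (l2_delta C j0 p.2) = l2_delta C (i0, j0) p.
Proof.
apply/ffunP => q; rewrite !ffunE; case: p q => [a b] [c d] /=.
by rewrite -natrM mulnb xpair_eqE.
Qed.

(** The tensors of basis vectors are the basis of [K], so the values of [f] on pairs of basis
    vectors define [F] and determine it. *)
Lemma l2_ten_univ (V : lmodType C) (f : H -> G -> V) : bilinear_map f ->
  exists! F : K -> V, linear F /\ forall h g, F (l2_ten h g) = f h g.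
Proof.
move=> [fr fl].
pose F (k : K) : V :=
  \sum_p (k p : C) *: f (l2_delta C i0 p.1) (l2_delta C j0 p.2).
exists F; split; first split.
- move=> a k l; rewrite /F scaler_sumr -big_split; apply: eq_bigr => p _ /=.
  by rewrite !ffunE scalerDl scalerA.
- move=> h g; rewrite [h in RHS]l2_sum_delta [g in RHS]l2_sum_delta.
  rewrite (linear_sumZ (F := f^~ _)) //.
  under eq_bigr => i _ do rewrite (linear_sumZ _ _ (fr _)) scaler_sumr.
  rewrite pair_bigA; apply: eq_bigr => p _ /=.
  by rewrite ffunE scalerA.
move=> F' [lF' eF']; apply/funext => k.
rewrite [in RHS](l2_sum_delta k) linear_sumZ //; apply: eq_bigr => p _.
by rewrite -l2_ten_delta eF'.
Qed.

Lemma l2_ten_inner (h h' : H) (g g' : G) :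
  inner (l2_ten h g) (l2_ten h' g') = inner h h' * inner g g'.
Proof.
rewrite /inner /= /l2_inner big_distrlr pair_bigA; apply: eq_bigr => p _ /=.
by rewrite !ffunE rmorphM mulrACA.
Qed.

Lemma l2_ten_Omega : l2_ten Omega Omega = Omega.
Proof. exact: (l2_ten_delta (i0, j0)). Qed.

Definition l2_tensor : tensorProduct H G :=
  TensorProduct l2_ten_bilinear l2_ten_univ l2_ten_inner l2_ten_Omega.

End L2Tensor.

(** * Separation of the listed products *)

Section Separation.
Variables (C : numClosedFieldType).

(** Admissibility of [p] allows an explicit product state [theta] to be built; [coincide] makes the
    same [theta] a product for [q], and its moments are then computed in both ways. *)
Lemma coincide_moments (p q : lift_params C) :
  (forall l i, circle (lift_coord p l i) \/ lift_coord p l i = 0) ->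
  coincide p q ->
  forall l i m j,
    (lift_coord p l i)^* * lift_coord p m j =
    (lift_coord q l i)^* * lift_coord q m j.
Proof.
move=> hp pq l i m j.
(* One self-adjoint generator for each face. *)
pose A := free_twoFaced C unit unit.
pose P := free_coproduct C (unit + unit)%type (unit + unit)%type.
(* [H] is C^2 with basis indexed by [bool] and [Omega] at [false]; [X] below exchanges the two basis
   vectors and represents every generator. *)
pose H := l2 C false; pose K := l2_tensor C false false.
have negK : involutive negb by exact: negbK.
pose X : La H := l2_perm C false negK.
have sX : star X = X by exact: star_l2_perm.
pose pi : A -> La H := fs_lift (fun=> X).
have piE x : pi (gen x) = X by exact: fs_lift_gen.
have hpi : star_hom pi by exact: fs_lift_hom.
pose phi a := inner Omega (pi a Omega).
have rphi : represents pi phi by [].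
have sphi := represents_state rphi.
pose s (z : (unit + unit) + (unit + unit)) : La K :=
  match z with
  | inl (inl _) => left_lift K (gamma1 p) X
  | inl (inr _) => left_lift K (gamma2 p) X
  | inr (inl _) => right_lift K (delta1 p) X
  | inr (inr _) => right_lift K (delta2 p) X
  end.
(* The lifts preserve [star], so the values of [s] are self-adjoint and [s] extends to all of
   [P]. *)
have hl i' := left_lift_hom K (hp true i').
have hr i' := right_lift_hom K (hp false i').
have sl i' : star (left_lift K (lift_coord p true i') X) =
    left_lift K (lift_coord p true i') X.
  by case: (hl i') => _ _ <-; rewrite sX.
have sr i' : star (right_lift K (lift_coord p false i') X) =
    right_lift K (lift_coord p false i') X.
  by case: (hr i') => _ _ <-; rewrite sX.
have ss z : star (s z) = s z.
  case: z => -[] a; [exact: (sl true)|exact: (sl false)| |].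
    exact: (sr true).
  exact: (sr false).
have hPi := fs_lift_hom ss.
pose theta (c : P) := inner Omega (fs_lift s c Omega).
have thp : @is_product C p A A P phi phi theta.
  exists H, H, K, pi, pi, (fs_lift s); do 3![split; first by []].
  (* The four conditions on the faces compare *-homomorphisms, so each is checked on a generator
     only. *)
  have face_ext (X0 : choiceType) (f g : freeStar C X0 -> La K) :
      star_hom f -> star_hom g -> (forall x, f (gen x) = g (gen x)) ->
      forall a, f a = g a.
    by move=> hf hg e a; rewrite (freeStar_hom_ext hf hg e).
  have i1 := fs_inl_hom C unit unit; have i2 := fs_inr_hom C unit unit.
  have j1 := fs_inl_hom C (unit + unit)%type (unit + unit)%type.
  have j2 := fs_inr_hom C (unit + unit)%type (unit + unit)%type.
  split; [|split; [|split; [|split=> //]]].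
  - apply: (@face_ext unit _ _).
    + exact: (star_hom_comp (star_hom_comp i1 j1) hPi).
    + exact: (star_hom_comp (star_hom_comp i1 hpi) (hl true)).
    + by move=> x; rewrite /= !fs_inl_gen fs_lift_gen piE.
  - apply: (@face_ext unit _ _).
    + exact: (star_hom_comp (star_hom_comp i2 j1) hPi).
    + exact: (star_hom_comp (star_hom_comp i2 hpi) (hl false)).
    + by move=> x; rewrite /= fs_inr_gen fs_inl_gen fs_lift_gen piE.
  - apply: (@face_ext unit _ _).
    + exact: (star_hom_comp (star_hom_comp i1 j2) hPi).
    + exact: (star_hom_comp (star_hom_comp i1 hpi) (hr true)).
    + by move=> x; rewrite /= fs_inl_gen fs_inr_gen fs_lift_gen piE.
  - apply: (@face_ext unit _ _).
    + exact: (star_hom_comp (star_hom_comp i2 j2) hPi).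
    + exact: (star_hom_comp (star_hom_comp i2 hpi) (hr false)).
    + by move=> x; rewrite /= !fs_inr_gen fs_lift_gen piE.
have thq := (pq A A P phi phi sphi sphi theta).1 thp.
pose x1 : face1 A := gen tt; pose x2 : face2 A := gen tt.
have pix (b : bool) : pi (if b then incl1 x1 else incl2 x2) = X.
  by case: b; rewrite /= ?fs_inl_gen ?fs_inr_gen piE.
have phi0 (b : bool) : phi (if b then incl1 x1 else incl2 x2) = 0.
  by rewrite /phi pix [X _]l2_perm_delta [LHS]l2_innerE ffunE.
have phi1 (b b' : bool) :
    phi (smul (star (if b then incl1 x1 else incl2 x2))
              (if b' then incl1 x1 else incl2 x2)) = 1.
  case: (hpi) => _ hM hS; rewrite /phi hM hS inner_star_smul !pix.
  by rewrite [X _]l2_perm_delta [LHS]l2_innerE ffunE eqxx.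
rewrite -(product_moments thp phi0 phi0 phi1 phi1).
by rewrite -(product_moments thq phi0 phi0 phi1 phi1).
Qed.

(** The default 1 of [head] lets the zero sequence count as normalized, as the product with all
    parameters 0 requires. *)
Definition normalized (s : seq C) : Prop := head 1 [seq c <- s | c != 0] = 1.

(** The products determine a sequence up to a phase, which normalization fixes. Common leading zeros
    are stripped by induction; once both heads are 1, the products with index [i = 0] are the
    entries themselves. *)
Lemma normalized_phase_inj (s t : seq C) : size s = size t ->
  normalized s -> normalized t ->
  (forall i j, (s`_i)^* * s`_j = (t`_i)^* * t`_j) -> s = t.
Proof.
rewrite /normalized.
elim: s t => [|a s IH] [|b t] //= [sz].
have [->|a0] := eqVneq a 0 => /= ns nt e.
  have b0 : b = 0.
    apply/eqP; rewrite -mul_conjC_eq0 mulrC.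
    by have /= <- := e 0%N 0%N; rewrite mulr0.
  move: nt; rewrite b0 eqxx => nt; congr (_ :: _).
  by apply: IH => // i j; exact: (e i.+1 j.+1).
have b1 : b = 1.
  move: nt; case: eqVneq => //= b0 _.
  have /eqP := e 0%N 0%N; rewrite /= b0 mulr0 ns mulr1 rmorph1.
  by rewrite oner_eq0.
rewrite ns b1 in e *; congr (_ :: _); apply: (eq_from_nth (x0 := 0)) => // j _.
by have := e 0%N j.+1; rewrite /= rmorph1 !mul1r.
Qed.

(* In this order, the first nonzero entry of a listed product is 1. *)
Definition coords (p : lift_params C) : seq C :=
  [:: delta2 p; gamma2 p; delta1 p; gamma1 p].

(** Odd positions hold the left lifts and the upper two positions face 1; beyond the end the default
    is 0, for which the products agree trivially. *)
Lemma nth_coords p i : (coords p)`_i =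
  if (i < 4)%N then lift_coord p (odd i) (1 < i)%N else 0.
Proof. by case: i => [|[|[|[|i]]]] //=; rewrite nth_nil. Qed.

Lemma coords_inj : injective coords.
Proof. by case=> a b c d [a' b' c' d'] [-> -> -> ->]. Qed.

Lemma circle_neq0 (z : C) : circle z -> z != 0.
Proof. by rewrite /circle => z1; rewrite -normr_eq0 z1 oner_eq0. Qed.

Lemma listed_normalized (p : lift_params C) : listed p -> normalized (coords p).
Proof.
rewrite /normalized.
by case=> [z hz|z hz|z hz|z hz|z hz|z hz|z hz|z hz|z hz|||||||];
  rewrite /= ?oner_eq0 ?eqxx /= ?oner_eq0 ?eqxx.
Qed.

Lemma listed_circle (p : lift_params C) l i :
  listed p -> circle (lift_coord p l i) \/ lift_coord p l i = 0.
Proof.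
have c1 : circle (1 : C) by exact: normr1.
by case=> [z hz|z hz|z hz|z hz|z hz|z hz|z hz|z hz|z hz|||||||];
  case: l i => -[] /=; auto.
Qed.

Lemma listed_coincide_inj (p q : lift_params C) :
  listed p -> listed q -> coincide p q -> p = q.
Proof.
move=> lp lq pq; apply: coords_inj; apply: normalized_phase_inj => //.
- exact: listed_normalized.
- exact: listed_normalized.
have e := coincide_moments (fun l i => listed_circle l i lp) pq.
move=> i j; rewrite !nth_coords.
by case: ifP => _; case: ifP => _; rewrite ?rmorph0 ?mulr0 ?mul0r.
Qed.

(** * Reduction of admissible parameters to the listed ones *)

Variant Jtens_spec : C -> C -> Prop :=
| JtensDiag z of circle z : Jtens_spec z z
| JtensLeft z of circle z : Jtens_spec z 0
| JtensRight z of circle z : Jtens_spec 0 z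
| JtensZero : Jtens_spec 0 0.

Lemma JtensP (g d : C) : Jtens g d -> Jtens_spec g d.
Proof.
case=> [[hg|->] [hd|->]] hJ; try by constructor.
case: hJ => [<-|g0|d0]; first by constructor.
- by have := circle_neq0 hg; rewrite g0 eqxx.
- by have := circle_neq0 hd; rewrite d0 eqxx.
Qed.

(** The phase [u] is the conjugate of a nonzero parameter of face 2, or of face 1 if face 2
    vanishes, or 1 if all parameters are 0. In the first case a nonzero parameter of face 1 becomes
    the parameter of the family. *)
Lemma listed_scale (g1 d1 g2 d2 : C) : Jtens g1 d1 -> Jtens g2 d2 ->
  exists2 u, circle u & listed (scale_params u (TT g1 d1 g2 d2)).
Proof.
have circJ z : circle z -> circle z^* by rewrite /circle norm_conjC.
have circM z w : circle z -> circle w -> circle (z * w).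
  by rewrite /circle normrM => -> ->; rewrite mulr1.
have cK z : circle z -> z^* * z = 1.
  by move=> z1; rewrite mulrC -normCK z1 expr1n.
have c1 : circle (1 : C) by exact: normr1.
move=> /JtensP J1 /JtensP J2.
case: J2 => [z hz|z hz|z hz|].
1-3: by exists z^*; [exact: circJ|case: J1 => [w hw|w hw|w hw|];
  rewrite /scale_params /= ?cK ?mulr0 //; constructor; auto].
case: J1 => [z hz|z hz|z hz|].
1-3: by exists z^*; [exact: circJ|
  rewrite /scale_params /= ?cK ?mulr0 //; constructor].
by exists 1 => //; rewrite /scale_params /= !mulr0; constructor.
Qed.

Lemma coincide_sym (p q : lift_params C) : coincide p q -> coincide q p.
Proof. by move=> pq A B P phi psi sp sq th; split=> /pq; apply. Qed.

Lemma coincide_trans (p q r : lift_params C) :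
  coincide p q -> coincide q r -> coincide p r.
Proof.
move=> pq qr A B P phi psi sp sq th; have [a b] := pq A B P phi psi sp sq th.
by have [c d] := qr A B P phi psi sp sq th; split=> [/a/c|/d/b].
Qed.

End Separation.

Theorem theorem5p10 (R : realType) :
  (forall g1 d1 g2 d2 : R[i],
     Jtens g1 d1 -> Jtens g2 d2 ->
     exists! q : lift_params R[i], listed q /\ coincide (TT g1 d1 g2 d2) q) /\
  (forall q q' : lift_params R[i],
     listed q -> listed q' -> coincide q q' -> q = q').
Proof.
split; last by move=> q q'; exact: listed_coincide_inj.
move=> g1 d1 g2 d2 J1 J2; have [u hu lu] := listed_scale J1 J2.
have pu := coincide_scale (TT g1 d1 g2 d2) hu.
exists (scale_params u (TT g1 d1 g2 d2)); split=> // q [lq pq].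
exact: (listed_coincide_inj lu lq (coincide_trans (coincide_sym pu) pq)).
Qed.
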